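(* Let $G$ be a finite simple undirected graph with $n$ vertices and at least one edge, and let $\mu_2$ and $\mu_n$ denote the second smallest and the largest eigenvalue of the Laplacian matrix of $G$, respectively. If $n$ is odd and $2\mu_2 \ge \mu_n$, then $G$ is factor-critical.
   Context: The Laplacian matrix of a graph $G$ is $L = D - A$, where $D$ is the diagonal matrix of vertex degrees and $A$ is the adjacency matrix. The eigenvalues of $L$ are listed with multiplicity in nondecreasing order $0=\mu_1 \le \mu_2 \le \cdots \le \mu_n$. A perfect matching of a graph with an even number $m$ of vertices is a set of $m/2$ pairwise non-adjacent edges. A graph $G$ is factor-critical if for every vertex $v \in V(G)$, the graph $G - v$ has a perfect matching. *)

(* Defs.v *)
From mathcomp Require Import all_boot all_order all_algebra.
From mathcomp Require Import polyrcf complex.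

Set Implicit Arguments.
Unset Strict Implicit.
Unset Printing Implicit Defensive.

Import Order.TTheory GRing.Theory Num.Theory.
Local Open Scope ring_scope.

(* The eigenvalues of M lying in R, repeated according to their multiplicity
   as roots of the characteristic polynomial, in nondecreasing order.  For
   symmetric M this is the whole spectrum: see prod_eigenvalues. *)
Definition eigenvalues (R : rcfType) (n : nat) (M : 'M[R]_n) : seq R :=
  sort <=%R
    (flatten [seq nseq (mup x (char_poly M)) x | x <- rootsR (char_poly M)]).

Section Spectrum.
Variable R : rcfType.

Lemma sorted_eigenvalues (n : nat) (M : 'M[R]_n) : sorted <=%R (eigenvalues M).
Proof. exact/sort_sorted/le_total. Qed.

Lemma count_eigenvalues (n : nat) (M : 'M[R]_n) (x : R) :
  count_mem x (eigenvalues M) = mup x (char_poly M).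
Proof.
have p0 : char_poly M != 0 by rewrite monic_neq0 ?char_poly_monic.
rewrite /eigenvalues count_sort count_flatten -map_comp sumnE big_map.
under eq_bigr => y _ do rewrite /= count_nseq /=.
have urs : uniq (rootsR (char_poly M)).
  exact: (sorted_uniq lt_trans ltxx (sorted_roots _ _ _)).
have [xr|xr] := boolP (x \in rootsR (char_poly M)).
  rewrite (bigD1_seq x) //= eqxx mul1n big1 ?addn0 // => y yx.
  by rewrite (negbTE yx).
rewrite big_seq big1 => [|y yr]; last first.
  by rewrite (negbTE (_ : y != x)) //; apply: contraNneq xr => <-.
rewrite mupNroot //; apply: contra xr => rx.
by rewrite -(roots_on_rootsR p0 x) in_itv.
Qed.

Lemma symmetric_char_poly_split (n : nat) (M : 'M[R]_n) : M^T = M ->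
  exists s : seq R, char_poly M = \prod_(x <- s) ('X - x%:P).
Proof.
move=> symM; pose toC := real_complex R.
pose MC : 'M[R[i]]_n := map_mx toC M.
have hMC : MC \is hermsymmx.
  apply/is_hermitianmxP; rewrite expr0 scale1r.
  apply/matrixP => i j; rewrite !mxE -[in RHS]symM mxE.
  by apply/esym/CrealP; rewrite complex_real.
have /orthomx_spectralP eMC := hermitian_normalmx hMC.
have dreal := hermitian_spectral_diag_real hMC.
set P := spectralmx MC in eMC; set d := spectral_diag MC in eMC dreal.
have uP : P \in unitmx := spectral_unit MC.
have cp : char_poly MC = \prod_(i < n) ('X - (d 0 i)%:P).
  have -> : char_poly MC = char_poly (diag_mx d).
    have QP : map_mx polyC (invmx P) *m map_mx polyC P = 1%:M.
      by rewrite -map_mxM mulVmx // map_mx1.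
    have detQP := congr1 determinant QP; rewrite det_mulmx det1 in detQP.
    have -> : char_poly MC = \det (map_mx polyC (invmx P) *m
        char_poly_mx (diag_mx d) *m map_mx polyC P).
      rewrite /char_poly /char_poly_mx mulmxBr mulmxBl mul_mx_scalar.
      by rewrite -scalemxAl QP scalemx1 -!map_mxM -eMC.
    by rewrite !det_mulmx mulrAC detQP mul1r.
  rewrite char_poly_trig ?diag_mx_is_trig //.
  by apply: eq_bigr => i _; rewrite mxE eqxx mulr1n.
exists [seq complex.Re (d 0 i) | i <- enum 'I_n].
apply: (@map_poly_inj _ _ toC).
rewrite map_char_poly -/MC cp rmorph_prod big_map big_enum /=.
apply: eq_bigr => i _; rewrite rmorphB /= map_polyX map_polyC /=.
by congr ('X - _%:P); rewrite /toC RRe_real //; apply: (mxOverP dreal).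
Qed.

Lemma prod_eigenvalues (n : nat) (M : 'M[R]_n) : M^T = M ->
  char_poly M = \prod_(x <- eigenvalues M) ('X - x%:P).
Proof.
move=> /symmetric_char_poly_split [s sE]; rewrite {1}sE.
apply: perm_big; apply/allP => x _; apply/eqP.
by rewrite count_eigenvalues sE mu_prod_XsubC.
Qed.

Lemma size_eigenvalues (n : nat) (M : 'M[R]_n) : M^T = M ->
  size (eigenvalues M) = n.
Proof.
move=> symM; apply: succn_inj.
by rewrite -(size_prod_XsubC _ id) -prod_eigenvalues // size_char_poly.
Qed.

End Spectrum.

(* A finite simple graph is a symmetric irreflexive relation e : rel T on a
   finite vertex type T. *)

Definition degree (T : finType) (e : rel T) (v : T) : nat := #|[set w | e v w]|.

Definition adjacency (R : pzRingType) (T : finType) (e : rel T) : 'M[R]_#|T| :=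
  \matrix_(i, j) (e (enum_val i) (enum_val j))%:R.

Definition laplacian (R : pzRingType) (T : finType) (e : rel T) : 'M[R]_#|T| :=
  diag_mx (\row_i (degree e (enum_val i))%:R) - adjacency R e.

(* 1-based, as in mu_1 <= mu_2 <= ... <= mu_n; the value at an index outside
   1..n is irrelevant. *)
Definition laplacian_eigenvalue
    (R : rcfType) (T : finType) (e : rel T) (k : nat) : R :=
  (eigenvalues (laplacian R e))`_k.-1.

Lemma laplacian_sym (R : pzRingType) (T : finType) (e : rel T) :
  symmetric e -> (laplacian R e)^T = laplacian R e.
Proof.
move=> se; apply/matrixP => i j; rewrite !mxE se eq_sym.
by case: eqP => [->|].
Qed.

Definition edges (T : finType) (e : rel T) : {set {set T}} :=
  [set E : {set T} | [exists x, exists y, e x y && (E == [set x; y])]].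

(* Distinct edges are non-adjacent exactly when they are disjoint as sets. *)
Definition perfect_matching (T : finType) (e : rel T) (M : {set {set T}}) : bool :=
  [&& ~~ odd #|T|, M \subset edges e, trivIset M & #|M| == #|T|./2].

Definition delete_vertex (T : finType) (e : rel T) (v : T) :
    rel {x : T | x != v} :=
  fun x y => e (val x) (val y).
Arguments delete_vertex {T} e v _ _.

Definition factor_critical (T : finType) (e : rel T) : Prop :=
  forall v : T, exists M, perfect_matching (delete_vertex e v) M.

(* Main.v *)
Require Import Defs.
From mathcomp Require Import all_boot all_order all_algebra.
From mathcomp Require Import complex ring zify.

(** Two facts combine.

    Combinatorially, by Gallai's criterion, a graph of odd order that is not
    factor-critical has a nonempty vertex set S whose complement splits into
    more than |S| nonempty parts with no edges between distinct parts.  It is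
    obtained from the Tutte-Berge formula for G - v ([tutte_berge],
    [factor_critical_of_separated]); that formula rests on Gallai's lemma, here
    the statement that never being missed by the same maximum matching is a
    transitive relation ([never_both_trans]).

    Spectrally, such a set cannot exist when 2 mu_2 >= mu_n
    ([separated_le_card]).  Evaluate the Laplacian form at indicator vectors of
    vertex sets X, where it counts the edges leaving X and, by the Rayleigh
    bounds on the complement of the all-ones vector, lies between mu_2 and mu_n
    times |X| (n - |X|) / n.  Edges leaving S are exactly the edges leaving the
    parts, so the upper bound for S is to be compared with the sum of the lower
    bounds for the parts; with more than |S| parts the two are incompatible
    under 2 mu_2 >= mu_n.  The comparison is tight when the parts are |S| + 1
    singletons, and the strictness comes from Cauchy-Schwarz: distinct parts are
    orthogonal for the Laplacian but their centered indicators are not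
    orthogonal, so no part can attain its lower bound. *)

Set Implicit Arguments.
Unset Strict Implicit.
Unset Printing Implicit Defensive.

Import Order.TTheory GRing.Theory Num.Theory.

(** * Matchings as involutions *)

Section InvolutionPairs.
Variables (T : finType) (m : T -> T).
Hypothesis mK : involutive m.

Let moved := [set x | m x != x].
Definition involution_pairs := [set [set x; m x] | x in moved].

Lemma involution_pairs_partition : partition involution_pairs moved.
Proof.
have pairE x z : z \in [set x; m x] -> [set z; m z] = [set x; m x].
  by rewrite !inE => /orP[/eqP->|/eqP->] //; rewrite mK setUC.
apply/and3P; split.
- rewrite eqEsubset; apply/andP; split.
    apply/bigcupsP => _ /imsetP[x + ->]; rewrite inE => mx.
    apply/subsetP => z; rewrite !inE => /orP[/eqP->|/eqP->] //.
    by rewrite mK eq_sym.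
  apply/subsetP => x mx; apply/bigcupP; exists [set x; m x].
    exact: imset_f.
  by rewrite !inE eqxx.
- apply/trivIsetP => _ _ /imsetP[x _ ->] /imsetP[y _ ->].
  apply: contraR; case/pred0Pn => z /andP[/= zx zy].
  by rewrite -(pairE _ _ zx) (pairE _ _ zy).
- apply/imsetP => -[x _ /esym/setP/(_ x)].
  by rewrite !inE eqxx.
Qed.

Lemma card_involution_pairs : #|moved| = (#|involution_pairs| * 2)%N.
Proof.
apply: card_uniform_partition involution_pairs_partition.
by move=> _ /imsetP[x + ->]; rewrite inE cards2 eq_sym => ->.
Qed.

End InvolutionPairs.

Lemma perfect_matching_of_involution (T : finType) (e : rel T) (m : T -> T) :
  irreflexive e -> involutive m -> (forall x, e x (m x)) ->
  exists M, perfect_matching e M.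
Proof.
move=> e_irr mK em.
have moved x : m x != x by apply: contraTneq (em x) => ->; rewrite e_irr.
have cT : #|T| = (#|involution_pairs m| * 2)%N.
  rewrite -card_involution_pairs // -cardsT; apply/eq_card => x.
  by rewrite !inE moved.
exists (involution_pairs m); apply/and4P; split.
- by rewrite cT oddM andbF.
- apply/subsetP => _ /imsetP[x _ ->]; rewrite inE.
  by apply/existsP; exists x; apply/existsP; exists (m x); rewrite em eqxx.
- by have /and3P[] := involution_pairs_partition mK.
- by rewrite cT muln2 doubleK.
Qed.

(** * The Tutte-Berge formula and factor-criticality *)

Section TutteBerge.
Variables (T : finType) (e : rel T).
Hypotheses (e_sym : symmetric e) (e_irr : irreflexive e).
Implicit Types (A U : {set T}) (m M N : {ffun T -> T}) (x y t u v w : T).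

(** A matching is encoded as an involution whose fixed points are the vertices
    it does not cover; this makes exchanging edges a local update of a
    function. *)
Definition matching_in A m :=
  [forall x, (m (m x) == x) && ((m x != x) ==> (x \in A) && e x (m x))].

Definition missed A m := [set x in A | m x == x].

Definition maximum A m :=
  matching_in A m &&
  [forall m', matching_in A m' ==> (#|missed A m| <= #|missed A m'|)%N].

Lemma matchingP A m :
  reflect (involutive m /\ forall x, m x != x -> x \in A /\ e x (m x))
          (matching_in A m).
Proof.
apply: (iffP forallP) => [mP|[mK mA] x].
  split=> [x|x mx]; first by have /andP[/eqP] := mP x.
  by have /andP[_ /implyP/(_ mx)/andP[]] := mP x.
by rewrite mK eqxx; apply/implyP => /mA[-> ->].
Qed.

Lemma maximumP A m :
  reflect (matching_in A m /\
           forall m', matching_in A m' -> (#|missed A m| <= #|missed A m'|)%N)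
          (maximum A m).
Proof.
apply: (iffP andP) => -[mA mmax]; split=> //.
  by move=> m'; apply/implyP; apply: (forallP mmax).
by apply/forallP => m'; apply/implyP/mmax.
Qed.

(** Upgrades a deficiency gain of one, or a nonzero deficiency, to two. *)
Lemma odd_missed A m : matching_in A m -> odd #|missed A m| = odd #|A|.
Proof.
case/matchingP => mK mA.
have -> : missed A m = A :\: [set x | m x != x].
  by apply/setP => x; rewrite !inE negbK andbC.
have sA : [set x | m x != x] \subset A.
  by apply/subsetP => x; rewrite inE => /mA[].
have := cardsID [set x | m x != x] A; rewrite (setIidPr sA).
rewrite card_involution_pairs // => <-.
by rewrite oddD oddM andbF.
Qed.

Lemma ex_maximum A : exists m, maximum A m.
Proof.
have id_matching : matching_in A [ffun x => x].
  by apply/matchingP; split=> x; rewrite !ffunE ?eqxx.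
case: (arg_minnP (fun m => #|missed A m|) id_matching) => m mA mmin.
by exists m; apply/maximumP.
Qed.

(** For x missed by m, this adds the edge xy and drops the edge, if any, that
    covers y in m.  It augments m when y is missed as well, and otherwise shifts
    the missed vertex from x to the former partner m y. *)
Definition relink m x y : {ffun T -> T} :=
  [ffun w => if w == x then y else if w == y then x else
             if w == m y then w else m w].

Section Relink.
Variables (A : {set T}) (m : {ffun T -> T}) (x y : T).
Hypotheses (mA : matching_in A m) (xA : x \in A) (yA : y \in A).
Hypotheses (mx : m x = x) (exy : e x y).

Let xy : x != y.
Proof. by apply: contraTneq exy => ->; rewrite e_irr. Qed.

Let my_x : m y != x.
Proof.
have [mK _] := matchingP _ _ mA.
by apply: contraNneq xy => myx; rewrite -mx -myx mK.
Qed.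

Lemma relink_matching : matching_in A (relink m x y).
Proof.
have [mK mA'] := matchingP _ _ mA.
apply/matchingP; split=> w; rewrite !ffunE.
  have [->|wx] := eqVneq w x; first by rewrite eq_sym (negPf xy) eqxx.
  have [->|wy] := eqVneq w y; first by rewrite eqxx.
  have [wmy|wmy] := eqVneq w (m y).
    by rewrite (negPf wx) (negPf wy) wmy eqxx.
  have -> : m w == x = false.
    by apply: contraNF wx => /eqP mwx; rewrite -(mK w) mwx mx.
  have -> : m w == y = false.
    by apply: contraNF wmy => /eqP <-; rewrite mK.
  have -> : m w == m y = false.
    by apply: contraNF wy => /eqP /(can_inj mK) ->.
  exact: mK.
have [->|wx] := eqVneq w x; first by [].
have [->|wy] := eqVneq w y; first by rewrite e_sym.
have [wmy|wmy] := eqVneq w (m y); first by rewrite eqxx.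
exact: mA'.
Qed.

Lemma missed_relink : missed A (relink m x y) = (m y |: missed A m) :\ x :\ y.
Proof.
have [mK mA'] := matchingP _ _ mA.
apply/setP => w; rewrite !inE ffunE.
have [->|wx] := eqVneq w x.
  by rewrite [y == x]eq_sym (negPf xy) !andbF.
have [->|wy] := eqVneq w y; first by rewrite (negPf xy) !andbF.
have [wmy|//] := eqVneq w (m y); rewrite eqxx /= andbT.
by case: (mA' w) => //; rewrite wmy mK -wmy eq_sym.
Qed.

Lemma card_missed_augment :
  m y = y -> (#|missed A (relink m x y)| < #|missed A m|)%N.
Proof.
move=> my; rewrite missed_relink; apply: proper_card; apply/properP; split.
  apply/subsetP => w; rewrite !inE my.
  by case/and3P => /negPf -> _ /=.
by exists x; rewrite !inE ?xA ?mx ?eqxx ?andbF.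
Qed.

Lemma card_missed_relink :
  m y != y -> #|missed A (relink m x y)| = #|missed A m|.
Proof.
have [mK mA'] := matchingP _ _ mA.
move=> my; rewrite missed_relink.
have -> : (m y |: missed A m) :\ x :\ y = m y |: (missed A m :\ x).
  apply/setP => w; rewrite !inE.
  have [->|wy] := eqVneq w y; first by rewrite [y == m y]eq_sym (negPf my) !andbF.
  by have [->|] := eqVneq w x; first by rewrite eq_sym (negPf my_x).
have xm : x \in missed A m by rewrite inE xA mx eqxx.
rewrite cardsU1 [RHS](cardsD1 x) xm.
by rewrite !inE mK [y == _]eq_sym (negPf my) !andbF.
Qed.

End Relink.

Lemma maximum_missed_adjacent A m x y :
  maximum A m -> x \in missed A m -> y \in missed A m -> e x y = false.
Proof.
case/maximumP => mA mmax; rewrite !inE => /andP[xA /eqP mx] /andP[yA /eqP my].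
apply/negP => exy.
have := mmax _ (relink_matching mA xA yA mx exy).
by rewrite leqNgt card_missed_augment.
Qed.

(** Only meaningful for distinct u and v: for u = v it says that every maximum
    matching covers u. *)
Definition never_both A u v :=
  [forall m, maximum A m ==> ~~ ((m u == u) && (m v == v))].

Lemma never_bothP A u v :
  reflect (forall m, maximum A m -> m u = u -> m v <> v) (never_both A u v).
Proof.
apply: (iffP forallP) => [uv m mmax mu mv|uv m].
  by have := uv m; rewrite mmax mu mv !eqxx.
by apply/implyP => mmax; apply/andP => -[/eqP mu /eqP]; apply: uv.
Qed.

(** Gallai's lemma, in the form of a transitivity property.  Suppose M is
    maximum and misses u and v, and let N be a maximum matching missing t that
    agrees with M as much as possible.  N covers u and v, so, the two matchings
    having equal size, N misses a vertex x other than t that M matches to some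
    y.  Replacing the N-edge at y by xy gives a maximum matching that still
    misses t and agrees better with M. *)
Lemma never_both_trans A u t v :
    u \in A -> v \in A -> t \in A -> u != v ->
    (exists2 N, maximum A N & N t = t) ->
  never_both A u t -> never_both A t v -> never_both A u v.
Proof.
move=> uA vA tA uv [N0 N0max N0t] /never_bothP ut /never_bothP tv.
apply/never_bothP => M Mmax Mu Mv.
(* The vertices of the edges common to M and N. *)
pose agree N := [set w | (M w == N w) && (M w != w)].
have P0 : maximum A N0 && (N0 t == t) by rewrite N0max N0t eqxx.
case: (@arg_maxnP _ N0 (fun N => maximum A N && (N t == t))
  (fun N => #|agree N|) P0) => N /andP[Nmax /eqP Nt] Nbest.
have [MA Mmin] := maximumP _ _ Mmax.
have [NA Nmin] := maximumP _ _ Nmax.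
have [MK MA'] := matchingP _ _ MA.
have [NK NA'] := matchingP _ _ NA.
have NM : #|missed A N| = #|missed A M|.
  by apply/eqP; rewrite eqn_leq Mmin // Nmin.
(* M and N miss equally many vertices, and only M misses u and v. *)
have NDM : (1 < #|missed A N :\: missed A M|)%N.
  have -> : #|missed A N :\: missed A M| = #|missed A M :\: missed A N|.
    by rewrite !cardsD NM setIC.
  have <- : #|[set u; v]| = 2%N by rewrite cards2 uv.
  apply: subset_leq_card; apply/subsetP => w.
  rewrite !inE => /orP[] /eqP ->.
    rewrite uA Mu eqxx /= !andbT; apply/eqP => Nu.
    exact: ut Nmax Nu Nt.
  rewrite vA Mv eqxx /= !andbT; apply/eqP => Nv.
  exact: tv Nmax Nt Nv.
have [x xD xt] : exists2 x, x \in missed A N :\: missed A M & x != t.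
  have := cardsD1 t (missed A N :\: missed A M).
  have [->|[x]] := set_0Vmem ((missed A N :\: missed A M) :\ t).
    by rewrite cards0; lia.
  by rewrite in_setD1 => /andP[xt xD] _; exists x.
move: xD; rewrite !inE => /andP[+ /andP[xA /eqP Nx]]; rewrite xA /= => Mx.
have [_ exy] := MA' _ Mx; set y := M x in exy Mx.
have My : M y = x by rewrite MK.
have yA : y \in A by case: (MA' y); rewrite // My eq_sym.
have Ny : N y != y.
  apply/eqP => Ny; have := @maximum_missed_adjacent A N x y Nmax.
  by rewrite exy !inE xA yA Nx Ny !eqxx => /(_ isT isT).
(* The exchange: N' trades the edge of N at y for the edge xy of M. *)
have N'A := relink_matching NA xA yA Nx exy.
have ty : t == y = false by apply: contraNF Ny => /eqP <-; rewrite Nt.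
have := Nbest (relink N x y); rewrite ffunE [t == x]eq_sym (negPf xt) ty Nt.
have -> : maximum A (relink N x y).
  by apply/maximumP; split=> // m'; rewrite card_missed_relink //; apply: Nmin.
have -> : (if t == N y then t else t) == t by rewrite if_same.
move=> /(_ isT); apply/negP; rewrite -ltnNge.
apply/proper_card/properP; split; last first.
  by exists x; rewrite !inE ?ffunE ?eqxx ?Nx //= andbN.
apply/subsetP => w; rewrite !inE ffunE => /andP[/eqP MNw Mw].
rewrite Mw andbT.
have [->|wx] := eqVneq w x; first by [].
have [->|wy] := eqVneq w y; first by rewrite My.
have [wNy|_] := eqVneq w (N y); last by rewrite MNw.
by case/eqP: wx; rewrite -My -(MK w) MNw wNy NK.
Qed.

Definition separated (P : {set {set T}}) :=
  forall B C x y,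
    B \in P -> C \in P -> B != C -> x \in B -> y \in C -> e x y = false.

(** The hard direction of the Tutte-Berge formula.  When every vertex of A is
    missed by some maximum matching, no barrier is needed: the classes of the
    relation of never being missed together are separated, and a maximum
    matching misses at most one vertex in each.  A vertex covered by every
    maximum matching is instead moved into the barrier U, and induction applies
    to the rest.  The blocks of P need be neither connected nor odd; parity
    enters only through the number of missed vertices. *)
Lemma tutte_berge A : exists m U (P : {set {set T}}),
  [/\ matching_in A m, U \subset A, partition P (A :\: U), separated P
    & (#|U| + #|missed A m| <= #|P|)%N].
Proof.
have [n] := ubnP #|A|; elim: n A => // n IHn A; rewrite ltnS => An.
have [/existsP[v /andP[vA /forallP vP]]|] :=
  boolP [exists v in A, forall m, maximum A m ==> (m v != v)].
  have [|m' [U [P [m'A UA PA Pe UP]]]] := IHn (A :\ v).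
    by rewrite (cardsD1 v) vA in An.
  have [m mmax] := ex_maximum A; have [mA mmin] := maximumP _ _ mmax.
  have [m'K m'A'] := matchingP _ _ m'A.
  have m'v : m' v = v.
    by apply/eqP/negPn/negP => /m'A'[]; rewrite !inE eqxx.
  have m'inA : matching_in A m'.
    by apply/matchingP; split=> // x /m'A'[]; rewrite inE => /andP[].
  have missedE : missed A m' = v |: missed (A :\ v) m'.
    apply/setP => x; rewrite !inE.
    by have [->|] := eqVneq x v; first by rewrite vA m'v eqxx.
  have cmissed : #|missed A m'| = #|missed (A :\ v) m'|.+1.
    by rewrite missedE cardsU1 !inE eqxx.
  have lt_missed : (#|missed A m| < #|missed A m'|)%N.
    rewrite ltn_neqAle mmin // andbT; apply/eqP => eqm.
    have m'max : maximum A m'.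
      by apply/maximumP; split=> // m'' /mmin; rewrite eqm.
    by have := vP m'; rewrite m'max m'v eqxx.
  (* By parity, m misses at least two vertices fewer than m', one of which
     compensates for the growth of the barrier. *)
  have := odd_missed mA; rewrite -(odd_missed m'inA) => par.
  exists m, (v |: U), P; split=> //.
  - by rewrite subUset sub1set vA (subset_trans UA) // subsetDl.
  - by rewrite -setDDl.
  - rewrite cardsU1; have -> : v \notin U.
      by apply/negP => /(subsetP UA); rewrite !inE eqxx.
    by move: lt_missed par UP; rewrite cmissed; lia.
rewrite negb_exists => /forallP noess.
have ess t : t \in A -> exists2 N, maximum A N & N t = t.
  move=> tA; have := noess t; rewrite tA /= negb_forall => /existsP[N].
  by rewrite negb_imply negbK => /andP[Nmax /eqP Nt]; exists N.
pose R u v := (u == v) || never_both A u v.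
have Rsym u v : R u v = R v u.
  rewrite /R eq_sym; congr (_ || _).
  by apply/never_bothP/never_bothP => uv m mmax mv mu; apply: uv mmax mu mv.
have Rtrans u t v : u \in A -> t \in A -> v \in A -> R u t -> R t v -> R u v.
  move=> uA tA vA; rewrite /R.
  have [//|uv] := eqVneq u v.
  have [<-|_] /= := eqVneq u t; first by rewrite (negPf uv).
  have [<- //|_] /= := eqVneq t v.
  by apply: (never_both_trans uA vA tA uv (ess t tA)).
have Requiv : {in A & &, equivalence_rel R}.
  move=> u v w uA vA wA; split; first by rewrite /R eqxx.
  by move=> uv; apply/idP/idP; apply: Rtrans; rewrite // Rsym.
have PA := equivalence_partitionP Requiv.
set P := equivalence_partition R A in PA.
have [/eqP coverP trivP _] := and3P PA.
have [m mmax] := ex_maximum A; have [mA _] := maximumP _ _ mmax.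
exists m, set0, P; split; rewrite ?sub0set ?setD0 //.
  move=> B C x y BP CP BC xB yC; apply: contraNF BC => exy.
  have xA : x \in A by rewrite -coverP; apply/bigcupP; exists B.
  have yA : y \in A by rewrite -coverP; apply/bigcupP; exists C.
  rewrite -(def_pblock trivP BP xB) -(def_pblock trivP CP yC).
  rewrite eq_pblock ?coverP // pblock_equivalence_partition //.
  apply/orP; right; apply/never_bothP => m' m'max m'x m'y.
  have := @maximum_missed_adjacent A m' x y m'max.
  by rewrite exy !inE xA yA m'x m'y !eqxx => /(_ isT isT).
rewrite cards0 -(@card_in_imset _ _ (pblock P) (missed A m)).
  apply/subset_leq_card/subsetP => _ /imsetP[x + ->].
  rewrite inE => /andP[xA _].
  by rewrite pblock_mem // coverP.
move=> u v; rewrite !inE => /andP[uA /eqP mu] /andP[vA /eqP mv] /eqP.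
rewrite eq_pblock ?coverP // pblock_equivalence_partition //.
by case/orP => [/eqP //|/never_bothP/(_ _ mmax mu)].
Qed.

End TutteBerge.

(** Gallai's characterization: if some G - v had no perfect matching, it would
    have a barrier U leaving at least |U| + 2 parts, the deficiency being even
    because n is odd; adding v to U gives a nonempty set S leaving more than |S|
    parts. *)
Lemma factor_critical_of_separated (T : finType) (e : rel T) :
    symmetric e -> irreflexive e -> odd #|T| ->
    (forall (S : {set T}) (P : {set {set T}}), S != set0 ->
      partition P (~: S) -> separated e P -> (#|P| <= #|S|)%N) ->
  factor_critical e.
Proof.
move=> e_sym e_irr n_odd tough v.
have [m [U [P [mA UA PA Pe UP]]]] := tutte_berge e_sym e_irr (~: [set v]).
have missed0 : missed (~: [set v]) m = set0.
  apply/eqP; rewrite -cards_eq0.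
  have := odd_missed mA; rewrite cardsC1.
  have := tough (v |: U) P; rewrite setCU -setDE => /(_ _ PA Pe).
  rewrite cardsU1; have -> : v \notin U.
    by apply/negP => /(subsetP UA); rewrite !inE eqxx.
  have -> : v |: U != set0 by apply/set0Pn; exists v; rewrite !inE eqxx.
  by move=> /(_ isT); lia.
have [mK mA'] := matchingP _ _ _ mA.
have mv x : (m x != v) = (x != v).
  have mvv : m v = v.
    by apply/eqP/negPn/negP => /mA'[]; rewrite !inE eqxx.
  by rewrite -{1}mvv (inj_eq (can_inj mK)).
have mx x : x != v -> m x != x.
  move=> xv; apply/negP => mx.
  by have /setP/(_ x) := missed0; rewrite !inE xv mx.
pose m' (x : {x | x != v}) : {x | x != v} := insubd x (m (val x)).
have val_m' x : val (m' x) = m (val x) by rewrite val_insubd mv (valP x).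
apply: (@perfect_matching_of_involution _ (delete_vertex e v) m').
- by move=> x; rewrite /delete_vertex e_irr.
- by move=> x; apply: val_inj; rewrite !val_m'.
- by move=> x; rewrite /delete_vertex val_m'; case: (mA' (val x) (mx _ (valP x))).
Qed.

Local Open Scope ring_scope.

(** * Rayleigh bounds for real symmetric matrices *)

Section Form.
Variables (R : comPzRingType) (n : nat).
Implicit Types (M : 'M[R]_n) (u v w : 'rV[R]_n).
Definition bform M u v : R := (u *m M *m v^T) 0 0.

Lemma bformDl M u v w : bform M (u + v) w = bform M u w + bform M v w.
Proof. by rewrite /bform !mulmxDl mxE. Qed.

Lemma bformZl M a u w : bform M (a *: u) w = a * bform M u w.
Proof. by rewrite /bform -!scalemxAl mxE. Qed.

Lemma bform_sym M u v : M^T = M -> bform M u v = bform M v u.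
Proof.
move=> symM; rewrite /bform -[in LHS](trmxK (u *m M *m v^T)) mxE.
by rewrite !trmx_mul trmxK symM mulmxA.
Qed.

Lemma bform_suml M (I : finType) (P : {set I}) (F : I -> 'rV[R]_n) w :
  bform M (\sum_(i in P) F i) w = \sum_(i in P) bform M (F i) w.
Proof. by rewrite /bform !mulmx_suml summxE. Qed.

Lemma bform1E u v : bform 1%:M u v = \sum_i u 0 i * v 0 i.
Proof.
by rewrite /bform mulmx1 mxE; apply: eq_bigr => i _; rewrite mxE.
Qed.
End Form.

Section Rayleigh.
Variables (R : rcfType) (n : nat) (M : 'M[R]_n).
Hypothesis symM : M^T = M.
Local Open Scope sesquilinear_scope.
Local Notation toC := (real_complex R).

(** The Hermitian spectral theorem, with the diagonal identified, as a multiset,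
    with the list of real roots of the characteristic polynomial. *)
Lemma unitary_diagonalization : exists (P : 'M[R[i]]_n) (d : 'I_n -> R),
  [/\ P \is unitarymx,
      map_mx toC M = P ^t* *m diag_mx (\row_i toC (d i)) *m P
    & perm_eq (eigenvalues M) [seq d i | i <- enum 'I_n]].
Proof.
pose MC := map_mx toC M.
have hMC : MC \is hermsymmx.
  apply/is_hermitianmxP; rewrite expr0 scale1r.
  apply/matrixP => i j; rewrite !mxE -[in RHS]symM mxE.
  by apply/esym/CrealP; rewrite complex_real.
have /orthomx_spectralP eMC := hermitian_normalmx hMC.
have dreal := hermitian_spectral_diag_real hMC.
have uP := spectral_unitarymx MC.
set P := spectralmx MC in eMC uP; set d := spectral_diag MC in eMC dreal.
have dE : d = \row_i toC (complex.Re (d 0 i)).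
  by apply/rowP => j; rewrite mxE [RHS]RRe_real //; apply: (mxOverP dreal).
exists P, (fun i => complex.Re (d 0 i)); split=> //.
  by rewrite -dE -invmx_unitary.
apply/allP => x _; apply/eqP; rewrite count_eigenvalues.
rewrite -(mu_prod_XsubC x [seq complex.Re (d 0 i) | i <- enum 'I_n]).
congr (mup x _); apply: (@map_poly_inj _ _ toC).
rewrite map_char_poly -/MC rmorph_prod big_map big_enum /=.
have -> : char_poly MC = char_poly (diag_mx d).
  have PV : map_mx polyC (invmx P) *m map_mx polyC P = 1%:M.
    by rewrite -map_mxM mulVmx ?unitarymx_unit // map_mx1.
  have detPV : \det (map_mx polyC (invmx P)) * \det (map_mx polyC P) = 1.
    by rewrite -det_mulmx PV det1.
  rewrite -[RHS]mul1r -detPV mulrAC -!det_mulmx; congr (\det _).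
  rewrite /char_poly_mx mulmxBr mulmxBl mul_mx_scalar -scalemxAl PV scalemx1.
  by rewrite -!map_mxM -eMC.
rewrite char_poly_trig ?diag_mx_is_trig //.
apply: eq_bigr => i _; rewrite mxE eqxx mulr1n rmorphB /= map_polyX map_polyC.
by rewrite [in LHS]dE mxE.
Qed.

(** The unitary change of basis is complex although M is real, so a real
    quadratic form is diagonalized by complex coordinates; this is harmless as
    only their squared moduli enter the Rayleigh quotients. *)
Lemma rayleigh_coordinates :
  exists (d : 'I_n -> R) (y : 'rV[R]_n -> 'rV[R[i]]_n),
  [/\ perm_eq (eigenvalues M) [seq d i | i <- enum 'I_n],
      forall u v,
        toC (bform M u v) = \sum_i toC (d i) * (y u 0 i * (y v 0 i)^* ),
      forall u v, toC (bform 1%:M u v) = \sum_i y u 0 i * (y v 0 i)^*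
    & forall a u, u *m M = a *: u ->
        forall i, toC (d i) * y u 0 i = toC a * y u 0 i].
Proof.
have [P [d [uP eM eig]]] := unitary_diagonalization.
pose y (u : 'rV[R]_n) := map_mx toC u *m P ^t*.
have yT (v : 'rV[R]_n) : P *m (map_mx toC v)^T = (y v) ^t*.
  apply/matrixP => i j; rewrite !mxE rmorph_sum /=; apply: eq_bigr => k _.
  rewrite rmorphM !mxE /= conjCK mulrC; congr (_ * _).
  by apply/esym/CrealP; rewrite complex_real.
exists d, y; split=> //.
- move=> u v; have -> : toC (bform M u v) = map_mx toC (u *m M *m v^T) 0 0.
    by rewrite mxE.
  rewrite !map_mxM -map_trmx eM !mulmxA -/(y u) -mulmxA yT.
  rewrite mxE; apply: eq_bigr => i _; rewrite mul_mx_diag !mxE.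
  by rewrite mulrA; congr (_ * _); rewrite mulrC.
- move=> u v.
  have -> : toC (bform 1%:M u v) = map_mx toC (u *m v^T) 0 0.
    by rewrite mxE /bform mulmx1.
  rewrite map_mxM -map_trmx -[map_mx toC u](mulmxKtV _ uP) // -/(y u).
  rewrite -mulmxA yT mxE.
  by apply: eq_bigr => i _; rewrite !mxE.
- move=> a u uM i.
  have : map_mx toC (u *m M) *m P ^t* = map_mx toC (a *: u) *m P ^t*.
    by rewrite uM.
  rewrite map_mxM eM !mulmxA -/(y u) mulmxtVK // map_mxZ -scalemxAl -/(y u).
  by move=> /rowP/(_ i); rewrite mul_mx_diag !mxE mulrC.
Qed.

Lemma rayleigh_le u : bform M u u <= (eigenvalues M)`_n.-1 * bform 1%:M u u.
Proof.
have [d [y [eig yM y1 _]]] := rayleigh_coordinates.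
rewrite -lecR rmorphM /= yM y1 mulr_sumr; apply: ler_sum => i _.
apply: ler_wpM2r; first exact: mul_conjC_ge0.
rewrite lecR.
have : d i \in eigenvalues M by rewrite (perm_mem eig) map_f // mem_enum.
move=> /(nthP 0)[k ks <-].
rewrite (sorted_leq_nth le_trans le_refl) ?sorted_eigenvalues //.
all: by rewrite ?inE; move: ks; rewrite size_eigenvalues //; lia.
Qed.

(** The first eigenvector u need not be known to be first: an eigenvalue below
    the second smallest one is the smallest and simple, so orthogonality to u
    kills the only coordinate with a small eigenvalue. *)
Lemma rayleigh_ge a u v :
    u != 0 -> u *m M = a *: u -> a < (eigenvalues M)`_1 -> bform 1%:M v u = 0 ->
  (eigenvalues M)`_1 * bform 1%:M v v <= bform M v v.
Proof.
have [d [y [eig yM y1 yev]]] := rayleigh_coordinates.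
move=> u0 uM; set b := (eigenvalues M)`_1 => ab vu0.
have low_unique i j : d i < b -> d j < b -> i = j.
  move=> di dj; apply/eqP; apply: contraT => ij.
  have : (1 < count (fun x : R => (x < b)%R) (eigenvalues M))%N.
    rewrite (permP eig) -sum1_count big_map big_enum_cond /= sum1_card.
    have <- : #|[set i; j]| = 2%N by rewrite cards2 ij.
    apply/subset_leq_card/subsetP => k.
    by rewrite !inE unfold_in => /orP[] /eqP ->.
  rewrite ltnNge; case/negP; rewrite /b.
  case: (eigenvalues M) (sorted_eigenvalues M) => [|x0 [|x1 s]] //=.
    by rewrite addn0 leq_b1.
  case/andP=> _ /(order_path_min le_trans)/allP x1s.
  rewrite ltxx add0n -[leqRHS]addn0 leq_add ?leq_b1 // leqn0 eqn0Ngt -has_count.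
  by apply/hasPn => x /x1s; rewrite -leNgt.
have [i0 yi0] : exists i, y u 0 i != 0.
  apply/existsP; apply: contraNT u0; rewrite negb_exists => /forallP yu.
  have := y1 u u; rewrite big1 => [|i _]; last first.
    by have := yu i; rewrite negbK => /eqP ->; rewrite mul0r.
  move=> /eqP; rewrite (fmorph_eq0 toC) bform1E psumr_eq0 => [|i _]; last first.
    by rewrite -expr2 sqr_ge0.
  move=> /allP u2; apply/eqP/rowP => i; rewrite mxE.
  by have := u2 i (mem_index_enum _); rewrite -expr2 sqrf_eq0 => /eqP.
have di0 : d i0 = a.
  by apply: complexI; apply: (mulIf yi0); exact: yev.
have low i : i != i0 -> b <= d i.
  move=> ii0; rewrite leNgt; apply: contra ii0 => di; apply/eqP/low_unique => //.
  by rewrite di0.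
have yu i : i != i0 -> y u 0 i = 0.
  move=> ii0; have := yev _ _ uM i; apply: contra_eq => yi.
  rewrite (inj_eq (mulIf yi)) (inj_eq (@complexI R)).
  by rewrite gt_eqF // (lt_le_trans ab) // low.
have yv0 : y v 0 i0 = 0.
  have := y1 v u; rewrite vu0 (bigD1 i0) //= big1 ?addr0 => [|i /yu ->]; last first.
    by rewrite conjC0 mulr0.
  move=> /esym/eqP; rewrite mulf_eq0 conjC_eq0 (negPf yi0) orbF.
  by move/eqP.
rewrite -lecR rmorphM /= yM y1 mulr_sumr; apply: ler_sum => i _.
have [->|/low bi] := eqVneq i i0; first by rewrite yv0 mul0r !mulr0.
by apply: ler_wpM2r; [exact: mul_conjC_ge0 | rewrite lecR].
Qed.

End Rayleigh.

(** * Positive semidefinite forms and centering *)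

(** Cauchy-Schwarz: an isotropic vector of a positive semidefinite form is in
    its radical.  Otherwise u + t v has negative square for a suitable t of
    sign opposite to the value of the form at (u, v). *)
Lemma psd_form_gt0 (R : realFieldType) n (M : 'M[R]_n) (u v : 'rV[R]_n) :
    M^T = M -> (forall w, 0 <= bform M w w) -> bform M u v != 0 ->
  0 < bform M u u.
Proof.
move=> symM psd uv0; rewrite lt_neqAle psd andbT eq_sym.
apply: contraNneq uv0 => uu0.
pose k := bform M u v; pose c := bform M v v.
have c0 : 0 <= c by apply: psd.
have c1 : c + 1 != 0 by rewrite gt_eqF // ltr_wpDl.
(* The minimizer is - k / c; the shift by 1 covers the case c = 0. *)
pose t := - k / (c + 1).
have := psd (u + t *: v).
rewrite bformDl bformZl !(bform_sym _ (u + _)) // !bformDl !bformZl.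
rewrite (bform_sym v u) // uu0 -/k -/c.
have -> : 0 + t * k + t * (k + t * c) = - (k ^+ 2 * (c + 2) / (c + 1) ^+ 2).
  by rewrite /t; field.
rewrite oppr_ge0 pmulr_lle0 ?invr_gt0 ?exprn_gt0 ?ltr_wpDl //.
rewrite pmulr_lle0 ?ltr_wpDl // => k2.
by rewrite -sqrf_eq0 eq_le k2 sqr_ge0.
Qed.

Section Centering.
Variables (R : realFieldType) (n : nat).
Hypothesis n_gt0 : (0 < n)%N.

(** The orthogonal projection onto the complement of the all-ones vector. *)
Definition centering : 'M[R]_n := 1%:M - n%:R^-1 *: const_mx 1.

Lemma centering_sym : centering^T = centering.
Proof. by rewrite /centering linearB linearZ /= trmx1 trmx_const. Qed.

Lemma ones_centering m : const_mx 1 *m centering = 0 :> 'M[R]_(m, n).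
Proof.
apply/matrixP => i j; rewrite mulmxBr mulmx1 -scalemxAr !mxE.
under eq_bigr do rewrite !mxE mulr1.
by rewrite sumr_const card_ord mulVf ?subrr // pnatr_eq0 -lt0n.
Qed.

Lemma centering_idem : centering *m centering = centering.
Proof.
rewrite {1}/centering mulmxBl mul1mx -scalemxAl ones_centering.
by rewrite scaler0 subr0.
Qed.
End Centering.

(** * The Laplacian form at indicator vectors *)

Section Laplacian.
Variables (R : rcfType) (T : finType) (e : rel T).
Hypotheses (e_sym : symmetric e) (e_irr : irreflexive e).
Local Notation n := #|T|.
Local Notation L := (laplacian R e).
Local Notation mu k := (laplacian_eigenvalue R e k).
Local Notation C := (centering R n).
Implicit Types (X Y S B : {set T}) (P : {set {set T}}).

Definition indicator X : 'rV[R]_n := \row_i (enum_val i \in X)%:R.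

Lemma sum_enum_val (F : T -> R) : \sum_(i < n) F (enum_val i) = \sum_x F x.
Proof. by rewrite -(big_enum_val F); apply: eq_bigl. Qed.

Lemma bform_indicator (M : 'M[R]_n) (F : T -> T -> R) X Y :
    (forall i j, M i j = F (enum_val i) (enum_val j)) ->
  bform M (indicator X) (indicator Y) = \sum_(x in X) \sum_(y in Y) F x y.
Proof.
move=> MF; rewrite exchange_big /bform mxE [RHS]big_mkcond /=.
rewrite -(sum_enum_val (fun y => if y \in Y then \sum_(x in X) F x y else 0)).
apply: eq_bigr => j _; rewrite !mxE.
case: ifP => _; last by rewrite mulr0.
rewrite mulr1 [RHS]big_mkcond /=.
rewrite -(sum_enum_val (fun x => if x \in X then F x (enum_val j) else 0)).
apply: eq_bigr => i _; rewrite !mxE MF.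
by case: ifP => _; rewrite ?mul1r ?mul0r.
Qed.

Definition laplacian_entry x y : R :=
  (x == y)%:R * (degree e x)%:R - (e x y)%:R.

Lemma laplacianE i j : L i j = laplacian_entry (enum_val i) (enum_val j).
Proof. by rewrite /laplacian_entry !mxE (inj_eq enum_val_inj) mulr_natl. Qed.

Lemma laplacian_indicator X Y : [disjoint X & Y] ->
    (forall x y, x \in X -> y \in Y -> e x y = false) ->
  bform L (indicator X) (indicator Y) = 0.
Proof.
move=> dXY eXY; rewrite (bform_indicator _ _ laplacianE).
rewrite big1 // => x xX; rewrite big1 // => y yY.
rewrite /laplacian_entry eXY // subr0; case: eqP => [xy|_]; last by rewrite mul0r.
by rewrite -xy (disjointFr dXY xX) in yY.
Qed.

Lemma laplacian_vertex x :
  bform L (indicator [set x]) (indicator [set x]) = (degree e x)%:R.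
Proof.
rewrite (bform_indicator _ _ laplacianE) !big_set1 /laplacian_entry.
by rewrite eqxx e_irr mul1r subr0.
Qed.

Lemma dot_indicator X Y :
  bform 1%:M (indicator X) (indicator Y) = #|X :&: Y|%:R.
Proof.
pose F (x y : T) : R := (x == y)%:R.
have oneE (i j : 'I_n) : 1%:M i j = F (enum_val i) (enum_val j).
  by rewrite mxE /F (inj_eq enum_val_inj).
rewrite (bform_indicator _ _ oneE) -sum1_card natr_sum.
rewrite [RHS](eq_bigl (fun x => (x \in X) && (x \in Y))) => [|x]; last first.
  by rewrite inE.
rewrite [RHS]big_mkcondr /=; apply: eq_bigr => x xX.
rewrite /F.
have [xY|xY] := boolP (x \in Y).
  rewrite (bigD1 x) //= eqxx big1 ?addr0 // => y /andP[_ /negPf].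
  by rewrite eq_sym => ->.
by rewrite big1 // => y yY; case: eqP => // xy; rewrite xy yY in xY.
Qed.

Lemma centering_indicator X Y :
  bform C (indicator X) (indicator Y) =
  #|X :&: Y|%:R - #|X|%:R * #|Y|%:R / n%:R.
Proof.
pose G (x y : T) : R := (x == y)%:R - n%:R^-1.
have CE (i j : 'I_n) : C i j = G (enum_val i) (enum_val j).
  by rewrite !mxE mulr1 /G (inj_eq enum_val_inj).
rewrite (bform_indicator _ _ CE) /G.
under eq_bigr do rewrite sumrB sumr_const.
rewrite sumrB sumr_const; congr (_ - _); last first.
  by rewrite -mulrnA mulnC -[LHS]mulr_natl natrM.
pose F (x y : T) : R := (x == y)%:R.
have oneE (i j : 'I_n) : 1%:M i j = F (enum_val i) (enum_val j).
  by rewrite mxE /F (inj_eq enum_val_inj).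
by rewrite -dot_indicator (bform_indicator _ _ oneE).
Qed.

Lemma ones_laplacian : const_mx 1 *m L = 0 :> 'rV[R]_n.
Proof.
apply/rowP => j; rewrite !mxE.
under eq_bigr do rewrite !mxE mul1r.
rewrite sumrB (bigD1 j) //= eqxx mulr1n big1 ?addr0; last first.
  by move=> i /negPf ->; rewrite mulr0n.
apply/eqP; rewrite subr_eq0; apply/eqP.
rewrite (sum_enum_val (fun x => (e x (enum_val j))%:R)) /= -natr_sum.
rewrite /degree -sum1_card big_mkcond /=; congr (_%:R).
by apply: eq_bigr => x _; rewrite inE e_sym; case: (e _ _).
Qed.

(** The all-ones vector spans the kernel, since mu_2 is positive, so projecting
    it away leaves the spectrum between mu_2 and mu_n. *)
Lemma laplacian_bounds (u : 'rV[R]_n) : (0 < n)%N -> 0 < mu 2 ->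
  mu 2 * bform C u u <= bform L u u /\ bform L u u <= mu n * bform C u u.
Proof.
move=> n_gt0 mu2; have symL := laplacian_sym R e_sym.
have JL : const_mx 1 *m L = 0 :> 'M[R]_n.
  apply/row_matrixP => i; rewrite row_mul row0.
  have -> : row i (const_mx 1) = const_mx 1 :> 'rV[R]_n.
    by apply/rowP => j; rewrite !mxE.
  exact: ones_laplacian.
have CL : C *m L = L.
  by rewrite mulmxBl mul1mx -scalemxAl JL scaler0 subr0.
have LC : L *m C = L.
  by rewrite -[LHS]trmxK trmx_mul symL centering_sym CL symL.
have fL : bform L (u *m C) (u *m C) = bform L u u.
  rewrite /bform trmx_mul centering_sym !mulmxA -(mulmxA u) CL.
  by rewrite -(mulmxA u) LC.
have f1 : bform 1%:M (u *m C) (u *m C) = bform C u u.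
  rewrite /bform trmx_mul centering_sym mulmx1 !mulmxA -(mulmxA u).
  by rewrite centering_idem.
rewrite -fL -f1; split; last exact: rayleigh_le.
apply: (@rayleigh_ge _ _ _ symL 0 (const_mx 1)) => //.
- apply/eqP => /rowP/(_ (Ordinal n_gt0)); rewrite !mxE => /eqP.
  by rewrite oner_eq0.
- by rewrite ones_laplacian scale0r.
- rewrite /bform mulmx1 -mulmxA -[C]centering_sym -trmx_mul.
  by rewrite ones_centering // trmx0 mulmx0 mxE.
Qed.

(** Let s = |S|, let B range over P, and suppose that |P| > s.  The cut around S
    is the union of the cuts around the B's, so the Laplacian form at the
    indicator of S is the sum of its values at those of the B's.  The former is
    at most 2 mu_2 s (n - s) / n, while each of the latter exceeds
    mu_2 |B| (n - |B|) / n, where n - |B| is at least 2 s because B leaves room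
    for S and for at least s other parts.  Summing over B gives
    2 mu_2 s (n - s) / n < 2 mu_2 s (n - s) / n. *)
Lemma separated_le_card S P :
    (exists x y, e x y) -> 2 * mu 2 >= mu n -> S != set0 ->
    partition P (~: S) -> separated e P ->
  (#|P| <= #|S|)%N.
Proof.
move=> [x [y exy]] gap S0 PS sepP; rewrite leqNgt; apply/negP => SP.
have symL := laplacian_sym R e_sym.
have n_gt0 : (0 < n)%N by apply/card_gt0P; exists x.
have n0 : 0 < n%:R :> R by rewrite ltr0n.
have mun0 : 0 < mu n.
  have := rayleigh_le symL (indicator [set x]).
  rewrite laplacian_vertex dot_indicator setIid cards1 mulr1.
  apply: lt_le_trans; rewrite ltr0n; apply/card_gt0P; exists y.
  by rewrite inE.
have mu2 : 0 < mu 2 by rewrite -(pmulr_rgt0 _ (ltr0n R 2)) (lt_le_trans mun0).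
have [/eqP coverP trivP P0] := and3P PS.
have cS : n = (#|S| + \sum_(B in P) #|B|)%N.
  by rewrite -(card_partition PS) cardsC.
have cB_gt0 B : B \in P -> (0 < #|B|)%N.
  by move=> BP; rewrite card_gt0; apply: contraNneq P0 => <-.
have cB B : B \in P -> (#|B| + 2 * #|S| <= n)%N.
  move=> BP; rewrite cS (bigD1 B) //=.
  have : (\sum_(B' in P | B' != B) 1 <= \sum_(B' in P | B' != B) #|B'|)%N.
    by apply: leq_sum => B' /andP[/cB_gt0].
  rewrite sum1dep_card.
  have := cardsD1 B P; rewrite BP.
  have -> : [set B' | (B' \in P) && (B' != B)] = P :\ B.
    by apply/setP => B'; rewrite !inE andbC.
  rewrite add1n => cP le_rest; rewrite cP ltnS in SP.
  by rewrite mul2n -addnn addnCA !leq_add2l (leq_trans SP).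
(* S and its complement define the same cut: the all-ones vector is in the
   kernel, and distinct parts are orthogonal. *)
have LSS : bform L (indicator S) (indicator S) =
           \sum_(B in P) bform L (indicator B) (indicator B).
  have -> : indicator S = const_mx 1 - \sum_(B in P) indicator B.
    apply/rowP => i; rewrite !mxE summxE.
    have -> : \sum_(B in P) indicator B 0 i = (enum_val i \in ~: S)%:R.
      have [iS|iS] := boolP (enum_val i \in ~: S).
        move: (iS); rewrite -coverP => /bigcupP[B BP iB].
        rewrite (bigD1 B) //= mxE iB big1 ?addr0 // => B' /andP[B'P B'B].
        rewrite mxE; case: (boolP (enum_val i \in B')) => // iB'.
        rewrite -(def_pblock trivP BP iB) -(def_pblock trivP B'P iB') in B'B.
        by rewrite eqxx in B'B.
      rewrite big1 // => B BP; rewrite mxE.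
      rewrite -coverP in iS; case: (boolP (enum_val i \in B)) => // iB.
      by case/bigcupP: iS; exists B.
    by rewrite inE; case: (_ \in S); rewrite ?subr0 ?subrr.
  have bform_ones u : bform L (const_mx 1) u = 0.
    by rewrite /bform ones_laplacian mul0mx mxE.
  rewrite -scaleN1r bformDl bform_ones add0r bformZl bform_sym //.
  rewrite bformDl bform_ones add0r bformZl mulrA mulrNN !mul1r.
  rewrite bform_suml; apply: eq_bigr => B BP.
  rewrite bform_sym // bform_suml (bigD1 B) //=.
  rewrite big1 ?addr0 // => B' /andP[B'P B'B].
  apply: laplacian_indicator; first exact: (trivIsetP trivP).
  by move=> z w; apply: sepP.
(* The lower bound is strict: the positive semidefinite form L - mu_2 C takes
   the nonzero value mu_2 |B| |B'| / n at two distinct parts, so that neither is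
   isotropic.  This is where S != set0 is used, to have a second part. *)
have strict B : B \in P ->
    mu 2 * bform C (indicator B) (indicator B) <
    bform L (indicator B) (indicator B).
  move=> BP; rewrite -subr_gt0.
  have [B' B'P B'B] : exists2 B', B' \in P & B != B'.
    have /set0Pn[B' ] : P :\ B != set0.
      rewrite -card_gt0; have := cardsD1 B P; rewrite BP.
      rewrite add1n => cP; rewrite -ltnS -cP.
      by apply: leq_ltn_trans SP; rewrite card_gt0.
    by rewrite !inE eq_sym => /andP[B'B B'P]; exists B'.
  have formE u v : bform (L - mu 2 *: C) u v = bform L u v - mu 2 * bform C u v.
    by rewrite /bform mulmxBr mulmxBl -scalemxAr -scalemxAl !mxE.
  rewrite -formE; apply: (@psd_form_gt0 _ _ _ _ (indicator B')).
  - by rewrite linearB linearZ /= symL centering_sym.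
  - by move=> w; rewrite formE subr_ge0; case: (laplacian_bounds w n_gt0 mu2).
  - have dBB' : [disjoint B & B'] := trivIsetP trivP _ _ BP B'P B'B.
    rewrite formE laplacian_indicator //; last by move=> z w; apply: sepP.
    rewrite centering_indicator disjoint_setI0 // cards0 !sub0r mulrN opprK.
    by rewrite !mulf_neq0 ?invr_neq0 ?gt_eqF // ltr0n cB_gt0.
have [_] := laplacian_bounds (indicator S) n_gt0 mu2.
apply/negP; rewrite -ltNge LSS.
apply: (@le_lt_trans _ _ (\sum_(B in P)
          mu 2 * (2 * #|S|%:R * #|B|%:R / n%:R))).
  rewrite -mulr_sumr -mulr_suml -mulr_sumr -natr_sum centering_indicator setIid.
  have nE : n%:R = #|S|%:R + (\sum_(B in P) #|B|)%:R :> R by rewrite -natrD -cS.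
  set c : R := (\sum_(B in P) #|B|)%:R in nE *; set s : R := #|S|%:R in nE *.
  have -> : s - s * s / n%:R = s * c / n%:R.
    by rewrite nE; field; rewrite -nE gt_eqF.
  rewrite [leRHS](_ : _ = 2 * mu 2 * (s * c / n%:R)); last by ring.
  by apply: ler_wpM2r => //; rewrite !mulr_ge0 ?invr_ge0 ?ler0n.
apply: ltr_sum => [|B BP].
  have /set0Pn[B BP] : P != set0 by rewrite -card_gt0 (leq_ltn_trans _ SP).
  by apply/hasP; exists B; rewrite ?mem_index_enum.
apply: le_lt_trans (strict B BP); rewrite ler_pM2l // centering_indicator setIid.
have -> : #|B|%:R - #|B|%:R * #|B|%:R / n%:R =
          (n%:R - #|B|%:R) * #|B|%:R / n%:R :> R.
  by field; rewrite gt_eqF.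
rewrite ler_pM2r ?invr_gt0 // ler_wpM2r // lerBrDl -natrM -natrD ler_nat.
exact: cB.
Qed.
End Laplacian.

Theorem theorem1p5 (R : rcfType) (T : finType) (e : rel T)
    (e_sym : symmetric e) (e_irr : irreflexive e)
    (e_edge : exists x y : T, e x y)
    (n_odd : odd #|T|)
    (mu2_mun : 2 * laplacian_eigenvalue R e 2 >= laplacian_eigenvalue R e #|T|) :
  factor_critical e.
Proof.
apply: factor_critical_of_separated => // S P.
exact: (separated_le_card e_sym e_irr e_edge mu2_mun).
Qed.
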